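(* Let $n>1$, let $\mathbf{B}^n$ be the (Euclidean) unit ball in $\mathbf{C}^n$ and let $\Delta^n$ be the unit polydisc in $\mathbf{C}^n$. There is no $C^1$-Kobayashi isometry between $\mathbf{B}^n$ and $\Delta^n$, and there is no $C^1$-Carathéodory isometry between $\mathbf{B}^n$ and $\Delta^n$.
   Context: $\Delta$ is the open unit disc in $\mathbf{C}$. For a domain $D\subset\mathbf{C}^n$, $z\in D$ and $\xi\in\mathbf{C}^n$, the infinitesimal Kobayashi and Carathéodory metrics are $$F^K_D(z,\xi)=\inf\{1/\alpha:\alpha>0,\ \exists f:\Delta\to D\text{ holomorphic},\ f(0)=z,\ f'(0)=\alpha\xi\},$$ $$F^C_D(z,\xi)=\sup\{|df(z)\xi|: f:D\to\Delta\text{ holomorphic}\}.$$ A $C^1$-Kobayashi isometry between domains $D_1,D_2$ is a $C^1$-diffeomorphism $f$ from $D_1$ onto $D_2$ (not assumed holomorphic) with $f^*(F^K_{D_2})=F^K_{D_1}$, i.e. $F^K_{D_2}(f(z),df(z)\xi)=F^K_{D_1}(z,\xi)$ for all $z\in D_1$ and all tangent vectors $\xi$ at $z$ (tangent vectors being identified with elements of $\mathbf{C}^n$ and $df(z)$ being the real differential). A $C^1$-Carathéodory isometry is defined in the same way with $F^C$ in place of $F^K$. *)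

(* Defs.v *)
From mathcomp Require Import all_boot all_order all_algebra.
From mathcomp.real_closed Require Import complex.
From mathcomp Require Import all_classical all_reals all_analysis.

Set Implicit Arguments.
Unset Strict Implicit.
Unset Printing Implicit Defensive.

Import Order.TTheory GRing.Theory Num.Theory.
Import numFieldNormedType.Exports.
Local Open Scope classical_set_scope.
Local Open Scope ring_scope.

(* R[i] packed as a numClosedFieldType: the canonical normed-module structure
   of a numeric field over itself is inferred for [cplx R], but not for the
   bare type R[i]. *)
Definition cplx (R : realType) : numClosedFieldType := R[i].

(* As `|z| is a real element of [cplx R], the partial order of [cplx R]
   restricts to the usual order of R here and in the next definition. *)
Definition unit_disc (R : realType) : set (cplx R) := [set z | `|z| < 1].

Definition unit_ball (R : realType) (n : nat) : set 'rV[cplx R]_n :=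
  [set z | \sum_(i < n) `|z 0 i| ^+ 2 < 1].

Definition unit_polydisc (R : realType) (n : nat) : set 'rV[cplx R]_n :=
  [set z | forall i, @unit_disc R (z 0 i)].

Arguments unit_disc : clear implicits.
Arguments unit_ball : clear implicits.
Arguments unit_polydisc : clear implicits.

(* Functions are total; only their germs at the points of the open set D
   matter.  Differentiability is over the base field [cplx R], i.e. complex
   Frechet differentiability. *)
Definition holomorphic_on (R : realType) (V W : normedModType (cplx R))
    (D : set V) (f : V -> W) : Prop :=
  forall z, D z -> differentiable f z.

(* The metrics take values in \bar R, so that neither the infimum nor the
   supremum relies on a default value; both are finite on a domain. *)
Definition kobayashi (R : realType) (n : nat) (D : set 'rV[cplx R]_n)
    (z xi : 'rV[cplx R]_n) : \bar R :=
  ereal_inf [set r | exists2 alpha : R, 0 < alpha & r = (alpha^-1)%:E /\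
    exists f : cplx R -> 'rV[cplx R]_n,
      [/\ holomorphic_on (unit_disc R) f,
          forall t, unit_disc R t -> D (f t),
          f 0 = z &
          derive1 f 0 = (real_complex R alpha : cplx R) *: xi]].

(* The norm `|_| of [cplx R] takes its values in [cplx R]; normc is the same
   modulus as an element of R. *)
Definition caratheodory (R : realType) (n : nat) (D : set 'rV[cplx R]_n)
    (z xi : 'rV[cplx R]_n) : \bar R :=
  ereal_sup [set r | exists f : 'rV[cplx R]_n -> cplx R,
    [/\ holomorphic_on D f,
        forall w, D w -> unit_disc R (f w) &
        r = (ComplexField.Normc.normc ('d f z xi))%:E]].

(* Identification of C^n with R^(2n): (x, y) <-> x + i y. *)
Definition to_cplx (R : realType) (n : nat) (v : 'rV[R]_(n + n)) :
    'rV[cplx R]_n :=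
  \row_(j < n) Complex (v 0 (lshift n j)) (v 0 (rshift n j)).

Definition of_cplx (R : realType) (n : nat) (z : 'rV[cplx R]_n) :
    'rV[R]_(n + n) :=
  row_mx (\row_(j < n) complex.Re (z 0 j)) (\row_(j < n) complex.Im (z 0 j)).

Lemma of_cplxK (R : realType) (n : nat) :
  cancel (@of_cplx R n) (@to_cplx R n).
Proof.
move=> z; apply/rowP => j; rewrite mxE row_mxEl row_mxEr !mxE.
by case: (z 0 j).
Qed.

Lemma to_cplxK (R : realType) (n : nat) :
  cancel (@to_cplx R n) (@of_cplx R n).
Proof.
move=> v; rewrite -[RHS]hsubmxK; congr row_mx.
- by apply/rowP => j; rewrite !mxE.
- by apply/rowP => j; rewrite !mxE.
Qed.

Definition realify (R : realType) (n : nat)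
    (f : 'rV[cplx R]_n -> 'rV[cplx R]_n) : 'rV[R]_(n + n) -> 'rV[R]_(n + n) :=
  fun v => of_cplx (f (to_cplx v)).

Definition real_diff (R : realType) (n : nat)
    (f : 'rV[cplx R]_n -> 'rV[cplx R]_n) (z xi : 'rV[cplx R]_n) :
    'rV[cplx R]_n :=
  to_cplx ('d (realify f) (of_cplx z) (of_cplx xi)).

Definition C1_on (R : realType) (n : nat) (D : set 'rV[cplx R]_n)
    (f : 'rV[cplx R]_n -> 'rV[cplx R]_n) : Prop :=
  forall z, D z ->
    differentiable (realify f) (of_cplx z) /\
    {for of_cplx z, continuous (fun v => 'J (realify f) v)}.

Definition C1_diffeomorphism (R : realType) (n : nat)
    (D1 D2 : set 'rV[cplx R]_n) (f : 'rV[cplx R]_n -> 'rV[cplx R]_n) : Prop :=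
  exists g : 'rV[cplx R]_n -> 'rV[cplx R]_n,
    [/\ forall z, D1 z -> D2 (f z) /\ g (f z) = z,
        forall w, D2 w -> D1 (g w) /\ f (g w) = w,
        C1_on D1 f &
        C1_on D2 g].

Definition C1_kobayashi_isometry (R : realType) (n : nat)
    (D1 D2 : set 'rV[cplx R]_n) (f : 'rV[cplx R]_n -> 'rV[cplx R]_n) : Prop :=
  C1_diffeomorphism D1 D2 f /\
  forall z, D1 z -> forall xi,
    kobayashi D2 (f z) (real_diff f z xi) = kobayashi D1 z xi.

Definition C1_caratheodory_isometry (R : realType) (n : nat)
    (D1 D2 : set 'rV[cplx R]_n) (f : 'rV[cplx R]_n -> 'rV[cplx R]_n) : Prop :=
  C1_diffeomorphism D1 D2 f /\
  forall z, D1 z -> forall xi,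
    caratheodory D2 (f z) (real_diff f z xi) = caratheodory D1 z xi.

(* Main.v *)
(** The indicatrix of either metric of the ball at 0 is the Euclidean ball, while
    that of the polydisc at [a] is the polydisc [max_i |xi_i| / (1 - |a_i|^2) < 1].
    The real differential at 0 of an isometry would be a real-linear isomorphism
    between these two norms, but the Euclidean norm satisfies the parallelogram
    law and the max norm does not as soon as [n > 1].

    Explicit linear and Moebius maps bound the Caratheodory metrics from below
    and the Kobayashi metrics from above; the two bounds meet since the
    Caratheodory metric is at most the Kobayashi metric, which is the estimate
    [|h'(0)| <= 1] for holomorphic [h : Delta -> Delta].  As holomorphic only
    means complex differentiable at each point, this estimate needs Goursat's
    bisection argument: it shows that the circular means of [Re (c h(z) / z)]
    ([h] odd) do not depend on the radius, and the means tend to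
    [Re (c h'(0))] at radius 0 and are at most [|c|] at radius 1. *)

From HB Require Import structures.
Require Import Defs.
From mathcomp Require Import all_boot all_order all_algebra.
From mathcomp.real_closed Require Import complex.
From mathcomp Require Import all_classical all_reals all_analysis.
From mathcomp Require Import ring lra.
Set Implicit Arguments.
Unset Strict Implicit.
Unset Printing Implicit Defensive.
Import Order.TTheory GRing.Theory Num.Theory.
Import numFieldNormedType.Exports.
Local Open Scope classical_set_scope.
Local Open Scope ring_scope.

Local Notation normc := ComplexField.Normc.normc.

(** * Integrals of continuous functions on a segment, and bisection of rectangles *)

Section RealIntegral.
Context {R : realType}.
Notation mu := (@lebesgue_measure R).
Implicit Types (f g : R -> R) (a b c k e : R).

Definition integ f a b := \int[mu]_(x in `[a, b]) f x.

Definition cont_on f a b := {within `[a, b], continuous f}.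

Lemma cont_integrable f a b : cont_on f a b -> mu.-integrable `[a, b] (EFin \o f).
Proof.
by move=> cf; apply: continuous_compact_integrable => //; exact: segment_compact.
Qed.

Lemma cont_on_cst k a b : cont_on (fun=> k) a b.
Proof. by move=> ?; exact: cvg_cst. Qed.

Lemma integB f g a b : cont_on f a b -> cont_on g a b ->
  integ (fun x => f x - g x) a b = integ f a b - integ g a b.
Proof. by move=> cf cg; rewrite /integ RintegralB//; exact: cont_integrable. Qed.

Lemma integ_cst k a b : a <= b -> integ (fun=> k) a b = k * (b - a).
Proof.
move=> ab; rewrite /integ Rintegral_cst//.
congr (_ * _).
transitivity (fine (if (a%:E < b%:E)%E then b%:E - a%:E else 0)%E).
  by congr fine; exact: lebesgue_measure_itv.
by rewrite lte_fin; case: ltgtP ab => // -> _; rewrite subrr.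
Qed.

Lemma integ_split f a b c : a <= c -> c <= b -> cont_on f a b ->
  integ f a b = integ f a c + integ f c b.
Proof.
move=> ac cb cf; have ab := le_trans ac cb.
have itf := cont_integrable cf.
apply/eqP; rewrite addrC -subr_eq; apply/eqP.
rewrite /integ (Rintegral_itvB itf) ?bnd_simp//.
rewrite Rintegral_itv_obnd_cbnd//.
apply: integrableS itf => //; apply: subset_itv; by rewrite bnd_simp.
Qed.

Lemma le_integ f g a b : cont_on f a b -> cont_on g a b ->
  (forall x, a <= x <= b -> f x <= g x) -> integ f a b <= integ g a b.
Proof.
move=> cf cg fg; by apply: le_Rintegral => //; exact: cont_integrable.
Qed.

Lemma integ_near_cst f a b k e : a <= b -> cont_on f a b ->
  (forall x, a <= x <= b -> `|f x - k| <= e) ->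
  `|integ f a b - k * (b - a)| <= e * (b - a).
Proof.
move=> ab cf fk.
have cc l : cont_on (fun=> l) a b by exact: cont_on_cst.
rewrite ler_distl -mulrBl -mulrDl -!integ_cst//; apply/andP; split; apply: le_integ => //.
- by move=> x /fk; rewrite ler_distl => /andP[].
- by move=> x /fk; rewrite ler_distl => /andP[].
Qed.

End RealIntegral.

(** * Bisection: an additive rectangle function that is small at every point vanishes *)

Section Bisection.
Context {R : realType}.
(** [E a b c d] plays the boundary integral of a form over [[a, b] x [c, d]]; [small] is the local
    estimate that a closed form, differentiable at [(x, y)], satisfies there. *)
Variables (E : R -> R -> R -> R -> R) (a0 b0 c0 d0 : R).

Hypothesis addx : forall a m b c d, a0 <= a -> a <= m -> m <= b -> b <= b0 ->
  c0 <= c -> c <= d -> d <= d0 -> E a b c d = E a m c d + E m b c d.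
Hypothesis addy : forall a b c m d, a0 <= a -> a <= b -> b <= b0 ->
  c0 <= c -> c <= m -> m <= d -> d <= d0 -> E a b c d = E a b c m + E a b m d.
Hypothesis small : forall x y e, a0 <= x <= b0 -> c0 <= y <= d0 -> 0 < e ->
  exists2 r, 0 < r & forall a b c d, a0 <= a -> b <= b0 -> c0 <= c -> d <= d0 ->
   a <= x <= b -> c <= y <= d -> (b - a) + (d - c) < r ->
   `|E a b c d| <= e * ((b - a) + (d - c)) ^+ 2.

Let w k := (b0 - a0) / 2 ^+ k.
Let h k := (d0 - c0) / 2 ^+ k.

(* [p] is the lower left corner of a subrectangle of the [k]-th generation. *)
Let bad e k (p : R * R) :=
  [/\ a0 <= p.1, p.1 + w k <= b0, c0 <= p.2, p.2 + h k <= d0 &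
   e * (w k + h k) ^+ 2 < `|E p.1 (p.1 + w k) p.2 (p.2 + h k)|].

Let sub k (p q : R * R) :=
  [/\ p.1 <= q.1, q.1 + w k.+1 <= p.1 + w k, p.2 <= q.2 & q.2 + h k.+1 <= p.2 + h k].

Let wS k : w k = w k.+1 + w k.+1.
Proof. rewrite /w exprS; field. by rewrite expf_neq0 ?pnatr_eq0. Qed.
Let hS k : h k = h k.+1 + h k.+1.
Proof. rewrite /h exprS; field. by rewrite expf_neq0 ?pnatr_eq0. Qed.

Hypotheses (ab0 : a0 <= b0) (cd0 : c0 <= d0).

Let w_ge0 k : 0 <= w k.
Proof. by rewrite divr_ge0 ?subr_ge0// exprn_ge0. Qed.
Let h_ge0 k : 0 <= h k.
Proof. by rewrite divr_ge0 ?subr_ge0// exprn_ge0. Qed.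

(** Halving both sides divides the squared half-perimeter by four. If all four quarters were good,
    additivity and the triangle inequality would make the whole rectangle good. *)
Let bad_step e k p : bad e k p -> exists q, bad e k.+1 q /\ sub k p q.
Proof.
case: p => x y [/= ax xb cy yd].
have w1 := w_ge0 k.+1; have h1 := h_ge0 k.+1.
rewrite wS in xb *; rewrite hS in yd *.
set W := w k.+1 in w1 xb *; set H := h k.+1 in h1 yd *.
rewrite [x + (W + W)]addrA in xb *; rewrite [y + (H + H)]addrA in yd *.
rewrite (@addx _ (x + W)) ?lerDl//; last by rewrite -addrA lerDl addr_ge0.
rewrite (@addy _ (x + W) _ (y + H)) ?lerDl//; last by rewrite (le_trans _ xb) ?lerDl.
rewrite (@addy (x + W) _ _ (y + H)) ?lerDl//; last by rewrite (le_trans ax) ?lerDl.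
move=> lt4.
have {}lt4 : e * (W + H) ^+ 2 < `|E x (x + W) y (y + H)| \/
   e * (W + H) ^+ 2 < `|E x (x + W) (y + H) (y + H + H)| \/
   e * (W + H) ^+ 2 < `|E (x + W) (x + W + W) y (y + H)| \/
   e * (W + H) ^+ 2 < `|E (x + W) (x + W + W) (y + H) (y + H + H)|.
  set A := E _ _ _ _ in lt4 *; set B := E _ _ _ _ in lt4 *.
  set C := E _ _ _ _ in lt4 *; set D := E _ _ _ _ in lt4 *.
  have tri : `|A + B + (C + D)| <= `|A| + `|B| + (`|C| + `|D|).
    apply: (le_trans (ler_normD _ _)); apply: lerD; exact: ler_normD.
  have := lt_le_trans lt4 tri.
  rewrite (_ : (W + W + (H + H)) ^+ 2 = 4 * (W + H) ^+ 2); last by ring.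
  rewrite mulrCA; set S := e * _ => {}tri.
  case: (ltP S `|A|) => [?|A1]; first by left.
  case: (ltP S `|B|) => [?|B1]; first by right; left.
  case: (ltP S `|C|) => [?|C1]; first by right; right; left.
  case: (ltP S `|D|) => [?|D1]; first by right; right; right.
  by exfalso; clear -A1 B1 C1 D1 tri; lra.
case: lt4 => [|[|[|]]] lt4.
- exists (x, y); split; split; rewrite ?(wS k) ?(hS k) -/W -/H //=; clear -ax xb cy yd w1 h1; lra.
- exists (x, y + H); split; split; rewrite ?(wS k) ?(hS k) -/W -/H //=; clear -ax xb cy yd w1 h1; lra.
- exists (x + W, y); split; split; rewrite ?(wS k) ?(hS k) -/W -/H //=; clear -ax xb cy yd w1 h1; lra.
- exists (x + W, y + H); split; split; rewrite ?(wS k) ?(hS k) -/W -/H //=; clear -ax xb cy yd w1 h1; lra.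
Qed.

(** The common point is the supremum of the left endpoints: every right endpoint bounds them, as a
    comparison at index [maxn m k] shows. *)
Lemma nested_limit (x l : nat -> R) : (forall k, x k <= x k.+1) ->
  (forall k, 0 <= l k) -> (forall k, x k.+1 + l k.+1 <= x k + l k) ->
  exists z, forall k, x k <= z <= x k + l k.
Proof.
move=> xS l0 lS.
have xm m k : (m <= k)%N -> x m <= x k.
  by elim: k => [|k IH]; rewrite leq_eqVlt => /predU1P[->//|//] /IH /le_trans; apply.
have lm m k : (m <= k)%N -> x k + l k <= x m + l m.
  elim: k => [|k IH]; rewrite leq_eqVlt => /predU1P[->//|//] /IH.
  exact: le_trans.
have ub k : ubound (range x) (x k + l k).
  move=> _ [m _ <-]; apply: (@le_trans _ _ (x (maxn m k))).
    by apply: xm; rewrite leq_maxl.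
  rewrite (le_trans _ (lm _ _ (leq_maxr m k)))// lerDl l0//.
exists (sup (range x)) => k; apply/andP; split.
  by apply: ub_le_sup; [exists (x 0%N + l 0%N)|exists k].
by apply: ge_sup => //; exists (x 0%N), 0%N.
Qed.

(** Otherwise the whole rectangle is bad for a suitable [e], and nested bad rectangles shrink to a
    point where [small] contradicts badness. *)
Lemma bisection : E a0 b0 c0 d0 = 0.
Proof.
apply/eqP/negP => /negP E0.
set S := (b0 - a0) + (d0 - c0).
have S0 : 0 <= S by rewrite addr_ge0 ?subr_ge0.
(* The [+ 1] makes [e * S ^+ 2] strictly less than the value of [E], also for a degenerate rectangle
   with [S = 0]. *)
pose e := `|E a0 b0 c0 d0| / (S ^+ 2 + 1).
have e0 : 0 < e by rewrite divr_gt0 ?normr_gt0// ltr_wpDl// sqr_ge0.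
have bad0 : bad e 0 (a0, c0).
  split => //=; rewrite /w /h expr0 !divr1 ?(addrC a0) ?(addrC c0) ?subrK//.
  rewrite -/S /e mulrAC -mulrA gtr_pMr ?normr_gt0//.
  by rewrite ltr_pdivrMr ?mul1r ?ltrDl// ltr_wpDl// sqr_ge0.
have [p [p0 pS]] : exists p : nat -> R * R, p 0%N = (a0, c0) /\
    forall k, bad e k (p k) -> bad e k.+1 (p k.+1) /\ sub k (p k) (p k.+1).
  (* With badness moved inside the existential, the chosen successor is a total function and can be
     iterated. *)
  have stepP k q : exists q', bad e k q -> bad e k.+1 q' /\ sub k q q'.
    have [/bad_step[q' ?]|nb] := pselect (bad e k q); first by exists q'.
    by exists q.
  pose g k q := projT1 (cid (stepP k q)).
  exists (nat_rect (fun=> (R * R)%type) (a0, c0) g); split => // k.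
  exact: projT2 (cid (stepP k _)).
have pbad k : bad e k (p k) by elim: k => [|k /pS[]//]; rewrite p0.
have psub k : sub k (p k) (p k.+1) by have /pS[] := pbad k.
have [x xP] := @nested_limit (fun k => (p k).1) w (fun k => let: And4 h _ _ _ := psub k in h)
  w_ge0 (fun k => let: And4 _ h _ _ := psub k in h).
have [y yP] := @nested_limit (fun k => (p k).2) h (fun k => let: And4 _ _ h _ := psub k in h)
  h_ge0 (fun k => let: And4 _ _ _ h := psub k in h).
have [] := @small x y e.
- have := xP 0%N; rewrite p0 /w expr0 divr1/=; lra.
- have := yP 0%N; rewrite p0 /h expr0 divr1/=; lra.
- exact: e0.
move=> r r0 rP.
have [k kr] : exists k, w k + h k < r.
  have : (S * (2^-1) ^+ k @[k --> \oo]) --> S * 0.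
    by apply: cvgMr; apply: cvg_expr; rewrite ger0_norm; lra.
  rewrite mulr0 => /cvgrPdist_lt /(_ _ r0) [k _ /(_ k (leqnn k))] /=.
  rewrite sub0r normrN ger0_norm; last by rewrite mulr_ge0// exprn_ge0.
  by move=> kr; exists k; rewrite /w /h -mulrDl -exprVn.
have [ax xb cy yd] := pbad k; apply/negP; rewrite -leNgt.
have := rP _ _ _ _ ax xb cy yd (xP k) (yP k).
by rewrite !(addrC (p k).1) !(addrC (p k).2) !addrK; apply.
Qed.

End Bisection.

(** * Goursat's lemma for pointwise differentiable closed forms *)

Lemma differentiable_near (K : numFieldType) (V W : normedModType K) (f : V -> W) x e :
  differentiable f x -> 0 < e ->
  exists2 r, 0 < r & forall y, `|y - x| < r ->
    `|f y - f x - 'd f x (y - x)| <= e * `|y - x|.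
Proof.
move=> df e0; have /eqaddoP/(_ _ e0)/nbhs_ballP[r /= r0 rP] := diff_locally df.
exists r => // y yx.
have := rP (y - x); rewrite -ball_normE/= sub0r normrN => /(_ yx).
by rewrite !fctE /= subrK opprD addrA.
Qed.

Section Goursat.
Context {R : realType}.
Implicit Types (P Q : R * R -> R) (a b c d : R).

Lemma cont_hslice P a b y :
  (forall x, a <= x <= b -> differentiable P (x, y)) ->
  cont_on (fun x => P (x, y)) a b.
Proof.
move=> dP; apply/continuous_in_subspaceT => x; rewrite inE/= in_itv/= => xab.
apply: (@continuous_comp _ _ _ (fun x => (x, y)) P).
  apply/differentiable_continuous/differentiable_pair => //; exact: differentiable_cst.
exact/differentiable_continuous/dP.
Qed.

Lemma cont_vslice P x c d :
  (forall y, c <= y <= d -> differentiable P (x, y)) ->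
  cont_on (fun y => P (x, y)) c d.
Proof.
move=> dP; apply/continuous_in_subspaceT => y; rewrite inE/= in_itv/= => xab.
apply: (@continuous_comp _ _ _ (fun y => (x, y)) P).
  apply/differentiable_continuous/differentiable_pair => //; exact: differentiable_cst.
exact/differentiable_continuous/dP.
Qed.

Lemma cont_onB (f g : R -> R) a b : cont_on f a b -> cont_on g a b ->
  cont_on (fun x => f x - g x) a b.
Proof. by move=> cf cg x; apply: cvgB; [exact: cf|exact: cg]. Qed.

Lemma linear_pairE (f : {linear (R * R)%type -> R}) u v :
  f (u, v) = u * f (1, 0) + v * f (0, 1).
Proof.
have -> : (u, v) = u *: (1, 0) + v *: (0, 1) :> (R * R)%type.
  by congr (_, _); rewrite /= /GRing.scale /= !mulr0 !mulr1 ?addr0 ?add0r.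
by rewrite linearD !linearZ.
Qed.

Lemma dist_le_sub (u v p s t m e : R) : `|u - p - s| <= e -> `|v - p - t| <= e ->
  s - t = m -> `|u - v - m| <= 2 * e.
Proof.
move=> us vt <-; rewrite (_ : u - v - _ = (u - p - s) - (v - p - t)); last by ring.
by rewrite (le_trans (ler_normB _ _))// mulr_natl mulr2n lerD.
Qed.

Lemma dist_le_trans (u v p s t e : R) : `|u - p| <= s -> `|v - p| <= t ->
  s + t <= e -> `|u - v| <= e.
Proof.
move=> us vt; apply: le_trans; rewrite distrC in vt.
by rewrite (le_trans (ler_distD p _ _))// lerD.
Qed.

(** The difference of the two sides is, up to sign, the integral of [P dx + Q dy] along the
    boundary. The affine approximations of [P] and [Q] at a point contribute zero, by equality of
    the cross derivatives; the remainder is small against the squared half-perimeter. *)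
Lemma goursat P Q a0 b0 c0 d0 : a0 <= b0 -> c0 <= d0 ->
  (forall x y, a0 <= x <= b0 -> c0 <= y <= d0 ->
    [/\ differentiable P (x, y), differentiable Q (x, y) &
     'd P (x, y) (0, 1) = 'd Q (x, y) (1, 0)]) ->
  integ (fun x => P (x, d0) - P (x, c0)) a0 b0 =
  integ (fun y => Q (b0, y) - Q (a0, y)) c0 d0.
Proof.
move=> ab0 cd0 dPQ.
have cP a b y : a0 <= a -> b <= b0 -> c0 <= y <= d0 -> cont_on (fun x => P (x, y)) a b.
  by move=> aa bb ycd; apply: cont_hslice => x xab; have [] := dPQ x y ltac:(lra) ltac:(lra).
have cQ c d x : c0 <= c -> d <= d0 -> a0 <= x <= b0 -> cont_on (fun y => Q (x, y)) c d.
  by move=> cc dd xab; apply: cont_vslice => y ycd; have [] := dPQ x y ltac:(lra) ltac:(lra).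
have cPB a b c d : a0 <= a -> b <= b0 -> c0 <= c <= d0 -> c0 <= d <= d0 ->
    cont_on (fun x => P (x, d) - P (x, c)) a b.
  by move=> *; apply: cont_onB; apply: cP.
have cQB a b c d : a0 <= a <= b0 -> a0 <= b <= b0 -> c0 <= c -> d <= d0 ->
    cont_on (fun y => Q (b, y) - Q (a, y)) c d.
  by move=> *; apply: cont_onB; apply: cQ.
apply/eqP; rewrite -subr_eq0; apply/eqP.
apply: (@bisection _ (fun a b c d => integ (fun x => P (x, d) - P (x, c)) a b -
  integ (fun y => Q (b, y) - Q (a, y)) c d) a0 b0 c0 d0) => //.
- move=> a m b c d a0a am mb bb0 c0c cd dd0.
  have a0m := le_trans a0a am; have mb0 := le_trans mb bb0.
  have am0 := le_trans am mb0; have a0b := le_trans a0m mb.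
  have c0d := le_trans c0c cd; have cd0' := le_trans cd dd0.
  rewrite (@integ_split _ _ a b m)//; last by apply: cPB => //; apply/andP.
  rewrite !(@integB _ (fun y => Q (_, y))); try by apply: cQ => //; apply/andP.
  by ring.
- move=> a b c m d a0a ab bb0 c0c cm md dd0.
  have c0m := le_trans c0c cm; have md0 := le_trans md dd0.
  have cm0 := le_trans cm md0; have c0d := le_trans c0m md.
  have a0b := le_trans a0a ab; have ab0' := le_trans ab bb0.
  rewrite (@integ_split _ (fun y => Q (b, y) - Q (a, y)) c d m)//; last first.
    by apply: cQB => //; apply/andP.
  rewrite !(@integB _ (fun x => P (x, _))); try by apply: cP => //; apply/andP.
  by ring.
- move=> x y e xab ycd e0.
  have [dP dQ PQ] := dPQ x y xab ycd.
  (* Each integrand is a difference of two values, with error [2 * (e / 4 * S)]; the two sides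
     together then give [e / 2 * S ^+ 2]. *)
  have e40 : 0 < e / 4 by rewrite divr_gt0.
  have [r1 r10 r1P] := differentiable_near dP e40.
  have [r2 r20 r2P] := differentiable_near dQ e40.
  exists (Num.min r1 r2); first by rewrite lt_min r10.
  move=> a b c d a0a bb0 c0c dd0 xab' ycd'; rewrite lt_min => /andP[S1 S2].
  have /andP[ax xb] := xab'; have /andP[cy yd] := ycd'.
  have ab := le_trans ax xb; have cd := le_trans cy yd.
  have ab0' := le_trans ab bb0; have a0b := le_trans a0a ab.
  have cd0' := le_trans cd dd0; have c0d := le_trans c0c cd.
  set S := b - a + (d - c) in S1 S2 *.
  have nle u v : a <= u <= b -> c <= v <= d -> `|(u, v) - (x, y)| <= S.
    clear -xab' ycd' => uab vcd; rewrite prod_normE/= ge_max !ler_norml /S.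
    by apply/andP; split; apply/andP; split; lra.
  have P1 u v : a <= u <= b -> c <= v <= d ->
      `|P (u, v) - P (x, y) - 'd P (x, y) (u - x, v - y)| <= e / 4 * S.
    move=> uab vcd; have n1 := nle u v uab vcd.
    apply: (le_trans (r1P (u, v) (le_lt_trans n1 S1))).
    by rewrite ler_pM2l.
  have Q1 u v : a <= u <= b -> c <= v <= d ->
      `|Q (u, v) - Q (x, y) - 'd Q (x, y) (u - x, v - y)| <= e / 4 * S.
    move=> uab vcd; have n1 := nle u v uab vcd.
    apply: (le_trans (r2P (u, v) (le_lt_trans n1 S2))).
    by rewrite ler_pM2l.
  have [k kP kQ] : exists2 k, 'd P (x, y) (0, 1) = k & 'd Q (x, y) (1, 0) = k.
    by exists ('d P (x, y) (0, 1)).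
  have acb z : z = a \/ z = b -> a <= z <= b by case=> ->; rewrite ab lexx.
  have ccd z : z = c \/ z = d -> c <= z <= d by case=> ->; rewrite cd lexx.
  (* The contributions of [u - x] at the top and at the bottom cancel, so this integral and the next
     are both close to [k] times the area. *)
  have I1 : `|integ (fun x => P (x, d) - P (x, c)) a b - k * (d - c) * (b - a)|
       <= 2 * (e / 4 * S) * (b - a).
    apply: integ_near_cst => // [|u uab]; first by apply: cPB => //; apply/andP.
    apply: dist_le_sub (P1 u d uab (ccd _ (or_intror erefl)))
      (P1 u c uab (ccd _ (or_introl erefl))) _.
    by rewrite (linear_pairE _ (u - x) (d - y)) (linear_pairE _ (u - x) (c - y)) kP; ring.
  have I2 : `|integ (fun y => Q (b, y) - Q (a, y)) c d - k * (b - a) * (d - c)|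
       <= 2 * (e / 4 * S) * (d - c).
    apply: integ_near_cst => // [|v vcd]; first by apply: cQB => //; apply/andP.
    apply: dist_le_sub (Q1 b v (acb _ (or_intror erefl)) vcd)
      (Q1 a v (acb _ (or_introl erefl)) vcd) _.
    by rewrite (linear_pairE _ (b - x) (v - y)) (linear_pairE _ (a - x) (v - y)) kQ; ring.
  rewrite mulrAC in I1; apply: dist_le_trans I1 I2 _.
  rewrite -mulrDr -/S -!mulrA -expr2 mulrCA ler_pM2l// mulrA ler_piMl ?sqr_ge0//.
  by clear -R; lra.
Qed.

End Goursat.

(** * Circular means of holomorphic functions *)

Lemma is_diff_of_near (K : numFieldType) (V W : normedModType K) (f : V -> W)
    (df : {linear V -> W}) x : continuous df ->
  (forall e, 0 < e -> exists2 r, 0 < r & forall y, `|y - x| < r ->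
    `|f y - f x - df (y - x)| <= e * `|y - x|) ->
  is_diff x f df.
Proof.
move=> cdf fdf.
have fE : f \o shift x = cst (f x) + df +o_ 0 id.
  apply/eqaddoP => e e0; have [r r0 rP] := fdf e e0.
  apply/nbhs_ballP; exists r => //= y; rewrite -ball_normE/= sub0r normrN => yr.
  by have := rP (y + x); rewrite addrK !fctE /= opprD addrA; apply.
have dE := diff_unique cdf fE.
split => //; apply/diff_locallyP; rewrite dE; split => //.
Qed.


(** * Real parts of complex differentiable functions on the plane *)

Section ComplexReal.
Context {R : realType}.
Implicit Types (z w : cplx R) (q : cplx R -> cplx R) (p : R * R).

Lemma normC_normc z : `|z| = (real_complex R (normc z) : cplx R).
Proof. by []. Qed.

Lemma normc_lt z (r : R) : (`|z| < (real_complex R r : cplx R)) = (normc z < r).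
Proof. by rewrite normC_normc ltcR. Qed.

Lemma normc_le z (r : R) : (`|z| <= (real_complex R r : cplx R)) = (normc z <= r).
Proof. by rewrite normC_normc lecR. Qed.

(** Positivity in the partial order of [cplx R] forces the imaginary part to vanish; this converts
    complex radii into real ones. *)
Lemma gt0_cplx (e : cplx R) : 0 < e -> exists2 r : R, 0 < r & e = real_complex R r.
Proof.
case: e => a b; rewrite ltcE /= => /andP[/eqP -> a0]; by exists a.
Qed.

Lemma normc_ge0 z : 0 <= normc z.
Proof. by case: z => x y; rewrite sqrtr_ge0. Qed.

Lemma cdiff_near q z (e : R) : differentiable q z -> 0 < e ->
  exists2 r : R, 0 < r & forall w, normc (w - z) < r ->
    normc (q w - q z - 'd q z 1 * (w - z)) <= e * normc (w - z).
Proof.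
move=> dq e0; have e0' : 0 < (real_complex R e : cplx R) by rewrite ltcR.
have [r' /gt0_cplx[r r0 ->] rP] := differentiable_near dq e0'.
exists r => // w; rewrite -normc_lt => /rP.
have -> : 'd q z (w - z) = 'd q z 1 * (w - z).
  transitivity ('d q z ((w - z) *: 1)); first by rewrite [_ *: _]mulr1.
  by rewrite linearZ mulrC.
by rewrite !normC_normc -rmorphM lecR.
Qed.

Lemma ReB z w : complex.Re (z - w) = complex.Re z - complex.Re w.
Proof. by case: z; case: w. Qed.

Definition toC p : cplx R := Complex p.1 p.2.

Lemma toCB p p' : toC (p - p') = toC p - toC p'. Proof. by []. Qed.

Lemma normc_toC p : normc (toC p) <= 2 * `|p|.
Proof.
case: p => x y; rewrite /toC /= prod_normE /=.
set m := Num.max _ _.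
have m0 : 0 <= m by rewrite /m le_max normr_ge0.
rewrite -(ger0_norm (mulr_ge0 (ler0n R 2) m0)) -sqrtr_sqr ler_wsqrtr// exprMn.
have h t : `|t| <= m -> t ^+ 2 <= m ^+ 2.
  by rewrite -[t ^+ 2]real_normK ?num_real// => tm; rewrite ler_sqr ?nnegrE.
have := h x; have := h y; rewrite {1 3}/m !le_max !lexx orbT => /(_ isT) ? /(_ isT) ?.
have := sqr_ge0 m; lra.
Qed.

Lemma normc_Re z : `|complex.Re z| <= normc z.
Proof. by have := normc_ge_Re z; rewrite normC_normc lecR. Qed.

(** The real differential of the real part of a function with complex derivative [k]. *)
Definition Relin (k : cplx R) (d : R * R) : R := complex.Re (k * toC d).

Lemma Relin_linear k : linear (Relin k).
Proof. by case: k => a b c [x y] [x' y']; rewrite /Relin /toC /= /GRing.scale /=; ring. Qed.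

HB.instance Definition _ k := GRing.isLinear.Build R (R * R)%type R *%R (Relin k) (Relin_linear k).

Lemma Relin_continuous k : continuous (Relin k).
Proof.
move=> p; rewrite /Relin; case: k => a b.
apply: (@cvgB _ R^o); apply: cvgM; [exact: cvg_cst|exact: cvg_fst|exact: cvg_cst|exact: cvg_snd].
Qed.

Lemma is_diff_Re q p : differentiable q (toC p) ->
  is_diff p (fun p => complex.Re (q (toC p))) (Relin ('d q (toC p) 1)).
Proof.
move=> dq; apply: is_diff_of_near; first exact: Relin_continuous.
(* The halves of [e] and [r] absorb the factor 2 of [normc_toC], the norm of [R * R] being the max
   norm. *)
move=> e e0; have e20 : 0 < e / 2 by rewrite divr_gt0.
have [r r0 rP] := cdiff_near dq e20; exists (r / 2); first by rewrite divr_gt0.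
move=> y yr.
have yr' : normc (toC y - toC p) < r.
  by rewrite -toCB (le_lt_trans (normc_toC _))// mulrC -ltr_pdivlMr.
have := rP _ yr'; set D := q _ - _ - _ => DE.
rewrite [X in `|X|](_ : _ = complex.Re D); last first.
  by rewrite /D !ReB.
rewrite (le_trans (normc_Re _))// (le_trans DE)// -mulrA ler_pM2l// ler_pdivrMl//.
by rewrite -toCB normc_toC.
Qed.

End ComplexReal.

(** * Polar coordinates and invariance of circular means *)

Section Polar.
Context {R : realType}.
Implicit Types (q : cplx R -> cplx R) (p : R * R).

Definition polar p : R * R := (p.1 * cos p.2, p.1 * sin p.2).

Lemma normc_polar p : 0 <= p.1 -> normc (toC (polar p)) = p.1.
Proof.
move=> p0; rewrite /toC /polar /= !exprMn -mulrDr cos2Dsin2 mulr1.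
by rewrite sqrtr_sqr ger0_norm.
Qed.

Global Instance is_diff_fst p : is_diff p (fst : R * R -> R) fst.
Proof.
split; first by apply: (@linear_differentiable _ _ _ fst) => x; exact: cvg_fst.
by rewrite (@diff_lin _ _ _ fst) // => x; exact: cvg_fst.
Qed.

Global Instance is_diff_snd p : is_diff p (snd : R * R -> R) snd.
Proof.
split; first by apply: (@linear_differentiable _ _ _ snd) => x; exact: cvg_snd.
by rewrite (@diff_lin _ _ _ snd) // => x; exact: cvg_snd.
Qed.

Lemma is_diff_of_derive (f : R -> R) (x d : R) : is_derive x 1 f d -> is_diff x f ( *:%R^~ d).
Proof.
move=> fd; have df : derivable f x 1 by case: fd.
split; first exact/derivable1_diffP.
by rewrite deriv1E// derive1E; case: fd => _ ->.
Qed.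

Global Instance is_diff_cos (x : R) : is_diff x cos ( *:%R^~ (- sin x)).
Proof. exact: is_diff_of_derive. Qed.

Global Instance is_diff_sin (x : R) : is_diff x sin ( *:%R^~ (cos x)).
Proof. exact: is_diff_of_derive. Qed.

Definition dpolar p d : R * R :=
  (d.1 * cos p.2 - p.1 * sin p.2 * d.2, d.1 * sin p.2 + p.1 * cos p.2 * d.2).

Lemma is_diff_polar p : is_diff p polar (dpolar p).
Proof.
have dc : is_diff p (cos \o snd) (( *:%R^~ (- sin p.2)) \o snd) by exact: is_diff_comp.
have ds : is_diff p (sin \o snd) (( *:%R^~ (cos p.2)) \o snd) by exact: is_diff_comp.
have -> : polar = fun x => ((fst * (cos \o snd)) x, (fst * (sin \o snd)) x) by [].
apply: is_diff_eq; apply/funext => -[a b]; rewrite /dpolar !fctE /=.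
by congr (_, _); rewrite /= /GRing.scale /=; ring.
Qed.

Lemma is_diff_Re_polar q p k : differentiable q (toC (polar p)) ->
  'd q (toC (polar p)) 1 = k ->
  is_diff p (fun p => complex.Re (q (toC (polar p)))) (Relin k \o dpolar p).
Proof.
move=> /is_diff_Re + <- => dq; have dp := is_diff_polar p.
exact: (@is_diff_comp _ _ _ _ polar (dpolar p) _ _ p dp dq).
Qed.

(** If [q = U + i V] has derivative [k], then [- 'i * q] has real part [V] and derivative
    [- 'i * k]; so this is the polar equation [V_t / r = U_r]. *)
Lemma polar_cauchy_riemann (k : cplx R) p : p.1 != 0 ->
  p.1^-1 * Relin (- 'i * k) (dpolar p (0, 1)) = Relin k (dpolar p (1, 0)).
Proof.
by move=> p0; rewrite /dpolar /Relin /toC /=; case: k => a b /=; field.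
Qed.

(** The factor [1 / r] is constant in the angular direction, so only [V] gets differentiated. *)
Lemma diff_div_fst (V dV : R * R -> R) p : p.1 != 0 -> is_diff p V dV ->
  differentiable (fun p => V p * p.1^-1) p /\
  'd (fun p => V p * p.1^-1) p (0, 1) = p.1^-1 * dV (0, 1).
Proof.
move=> p0 VdV.
have dfst : differentiable (fst : R * R -> R) p by [].
pose g (p : R * R) := p.1^-1.
have dg := differentiableP (differentiableV dfst p0).
have [dVg dVgE] := is_diffM VdV dg; split => //.
rewrite -/g in dg dVg dVgE.
have gE : 'd g p (0, 1) = 0.
  have /(congr1 (fun f => f (0, 1))) := diffV dfst p0.
  rewrite -/g => ->; rewrite diff_val.
  exact: mulr0.
have /(congr1 (fun f => f (0, 1))) := dVgE.
move=> ->.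
transitivity (V p * 'd g p (0, 1) + g p * dV (0, 1)) => //.
by rewrite gE mulr0 add0r.
Qed.

(* In polar coordinates the Cauchy-Riemann equations say that the form
   [(V / r) dr + U dt], where [U + i V = q], is closed; the two radial sides of
   the rectangle [r1, r2] x [0, 2 pi] cancel by periodicity. *)
Lemma polar_mean q (r1 r2 : R) : 0 < r1 -> r1 <= r2 ->
  (forall z : cplx R, normc z <= r2 -> z != 0 -> differentiable q z) ->
  integ (fun t => complex.Re (q (toC (polar (r1, t))))) 0 (pi *+ 2) =
  integ (fun t => complex.Re (q (toC (polar (r2, t))))) 0 (pi *+ 2).
Proof.
move=> r10 r12 dq.
pose Q p := complex.Re (q (toC (polar p))).
pose q' := - ('i : cplx R) *: q.
pose V p := complex.Re (q' (toC (polar p))).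
pose P p := V p * p.1^-1.
have pi20 : 0 <= pi *+ 2 :> R by rewrite mulrn_wge0// pi_ge0.
have dPQ x y : r1 <= x <= r2 -> 0 <= y <= pi *+ 2 ->
    [/\ differentiable P (x, y), differentiable Q (x, y) &
        'd P (x, y) (0, 1) = 'd Q (x, y) (1, 0)].
  move=> /andP[rx xr] _.
  have x0 : 0 < x := lt_le_trans r10 rx.
  have dqp : differentiable q (toC (polar (x, y))).
    have E : normc (toC (polar (x, y))) = x by rewrite normc_polar//= ltW.
    apply: dq; first by rewrite E.
    apply/eqP => pol0; move: x0.
    by rewrite -[x]E pol0 ComplexField.Normc.normc0 ltxx.
  have dQ := is_diff_Re_polar dqp erefl.
  have dq'p : differentiable q' (toC (polar (x, y))) by exact: differentiableZ.
  have dq'1 : 'd q' (toC (polar (x, y))) 1 = - 'i * 'd q (toC (polar (x, y))) 1.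
    exact: (congr1 (fun f => f 1) (diffZ (- 'i) dqp)).
  have dV := is_diff_Re_polar dq'p dq'1.
  have x0' : (x, y).1 != 0 by rewrite gt_eqF.
  have [dP dPE] := diff_div_fst x0' dV.
  have [dQ1 dQE] := dQ.
  split; [exact: dP|exact: dQ1|].
  apply: (etrans dPE); apply: esym; apply: (etrans (congr1 (fun f => f (1, 0)) dQE)).
  by apply: esym; exact: polar_cauchy_riemann.
have := goursat r12 pi20 dPQ.
rewrite (_ : (fun x => P (x, _) - _) = fun=> 0) ?integ_cst// ?mul0r; last first.
  apply/funext => x; rewrite /P /V /polar /=.
  by rewrite -[pi *+ 2]add0r cosD2pi sinD2pi subrr.
move/esym/eqP; rewrite integB ?subr_eq0; first by move/eqP.
- by apply: cont_vslice => t tpi; have [] := dPQ r2 t; rewrite ?r12 ?lexx.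
- by apply: cont_vslice => t tpi; have [] := dPQ r1 t; rewrite ?r12 ?lexx.
Qed.

Lemma polar_cont q (r : R) a b : 0 < r ->
  (forall z : cplx R, normc z <= r -> z != 0 -> differentiable q z) ->
  cont_on (fun t => complex.Re (q (toC (polar (r, t))))) a b.
Proof.
move=> r0 dq; apply: (@cont_vslice _ (fun p => complex.Re (q (toC (polar p))))) => y _.
have E : normc (toC (polar (r, y))) = r by rewrite normc_polar//= ltW.
have dqp : differentiable q (toC (polar (r, y))).
  apply: dq; first by rewrite E.
  apply/eqP => pol0; move: r0.
  by rewrite -[r]E pol0 ComplexField.Normc.normc0 ltxx.
by case: (is_diff_Re_polar dqp erefl).
Qed.

End Polar.

(** * The Schwarz estimate *)

Section Schwarz.
Context {R : realType}.
Implicit Types (q h : cplx R -> cplx R).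

Lemma Re_derivative_le h (r : R) : 0 < r ->
  (forall z : cplx R, normc z <= r -> differentiable h z /\ normc (h z) <= 1) ->
  h 0 = 0 -> forall c : cplx R, complex.Re (c * 'd h 0 1) <= normc c / r.
Proof.
move=> r0 hr h0 c.
(* The default value of [z^-1] at 0 is harmless: only circles of positive radius are used. *)
pose q := fun z : cplx R => c * (h z * z^-1).
have dq (z : cplx R) : normc z <= r -> z != 0 -> differentiable q z.
  move=> zr z0; apply: (@differentiableM _ _ (cst c) (fun z => h z * z^-1)).
    exact: differentiable_cst.
  apply: (@differentiableM _ _ h (fun z => z^-1)); first by case: (hr z zr).
  exact: differentiableV.
have pi20 : 0 < pi *+ 2 :> R by rewrite mulrn_wgt0 ?pi_gt0.
have polr (s t : R) : 0 < s -> normc (toC (polar (s, t))) = s.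
  by move=> s0; rewrite normc_polar//= ltW.
apply/ler_addgt0Pr => e e0.
have n0 : normc (0 : cplx R) <= r by rewrite ComplexField.Normc.normc0 ltW.
have [h00 _] := hr 0 n0.
have c10 : 0 < normc c + 1 by rewrite ltr_wpDl ?normc_ge0.
(* The error of the first-order expansion of [h] at 0 is multiplied by [normc c]; the [+ 1] covers
   [c = 0]. *)
have e10 : 0 < e / (normc c + 1) by rewrite divr_gt0.
have [d d0 dP] := cdiff_near h00 e10.
have [s [s0 sr sd]] : exists s, [/\ 0 < s, s <= r & s < d].
  exists (Num.min r (d / 2)); rewrite lt_min r0 divr_gt0// ge_min lexx gt_min.
  by split => //; rewrite [d / 2 < d]ltr_pdivrMr// mulr_natr mulr2n ltrDl d0 orbT.
have := polar_mean s0 sr dq.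
set I1 := integ _ _ _; set I2 := integ _ _ _ => I12.
have I2le : I2 <= normc c / r * (pi *+ 2 - 0).
  rewrite -(integ_cst _ (ltW pi20)); apply: le_integ.
  - exact: polar_cont.
  - exact: cont_on_cst.
  - move=> t _; rewrite (le_trans (ler_norm _))// (le_trans (normc_Re _))//.
    rewrite /q !ComplexField.Normc.normcM ComplexField.Normc.normcV polr//.
    rewrite ler_wpM2l ?normc_ge0// ler_piMl ?invr_ge0 ?(ltW r0)//.
    have zr : normc (toC (polar (r, t))) <= r by rewrite polr.
    by have [_] := hr _ zr.
have I1ge : (complex.Re (c * 'd h 0 1) - e) * (pi *+ 2 - 0) <= I1.
  set k := _ - e.
  rewrite -(integ_cst k (ltW pi20)); apply: le_integ.
  - exact: cont_on_cst.
  - apply: (@polar_cont _ q s _ _ s0) => z zs; apply: dq; exact: le_trans zs sr.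
  - move=> t _; set z := toC (polar (s, t)).
    have zs : normc z = s by exact: polr.
    have z0 : z != 0.
      by apply: contraTneq s0 => zz; rewrite -zs zz ComplexField.Normc.normc0 ltxx.
    have := dP z; rewrite subr0 zs h0 subr0 => /(_ sd) zP.
    rewrite /k lerBlDr -lerBlDl -ReB (le_trans (ler_norm _))// (le_trans (normc_Re _))//.
    rewrite /q -mulrBr ComplexField.Normc.normcM.
    have -> : 'd h 0 1 - h z / z = - (h z - 'd h 0 1 * z) / z by field.
    rewrite ComplexField.Normc.normcM normcN ComplexField.Normc.normcV zs.
    rewrite mulrA ler_pdivrMr//.
    rewrite (le_trans (ler_wpM2l (normc_ge0 _) zP))// mulrA ler_pM2r//.
    by rewrite mulrA ler_pdivrMr // mulrC ler_pM2l// lerDl ler01.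
rewrite I12 in I1ge; have := le_trans I1ge I2le.
by rewrite subr0 ler_pM2r// lerBlDr.
Qed.

Lemma diff_compN h : differentiable h 0 -> 'd (h \o -%R) 0 1 = - 'd h 0 1.
Proof.
move=> dh.
have dN : is_diff (0 : cplx R) (-%R : cplx R -> cplx R) -%R.
  exact: is_diffN.
have {}dh : is_diff (- 0 : cplx R) h ('d h 0) by rewrite oppr0; exact: differentiableP.
have [_ E] := is_diff_comp dN dh.
apply: (etrans (congr1 (fun f => f 1) E)).
exact: linearN.
Qed.

Lemma normc_half_sub (a b : cplx R) : normc a <= 1 -> normc b <= 1 ->
  normc (2^-1 * (a - b)) <= 1.
Proof.
rewrite -3!normc_le rmorph1 => a1 b1; rewrite normrM normfV normr_nat ler_pdivrMl ?ltr0n// mulr1.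
by rewrite (le_trans (ler_normB _ _))// (_ : 2 = 1 + 1)// lerD.
Qed.

(** Taking for [c] the conjugate of [k] gives [r * normc k <= 1]; then [r = (1 + e)^-1] tends to
    1. *)
Lemma normc_le1 (k : cplx R) :
  (forall r : R, 0 < r -> r < 1 -> forall c : cplx R, complex.Re (c * k) <= normc c / r) ->
  normc k <= 1.
Proof.
move=> kP.
have [->|k0] := eqVneq k 0; first by rewrite ComplexField.Normc.normc0 ler01.
have nk0 : 0 < normc k.
  rewrite lt_neqAle normc_ge0 andbT eq_sym; apply: contra_neq k0.
  exact: ComplexField.Normc.eq0_normc.
have kr (r : R) : 0 < r -> r < 1 -> r * normc k <= 1.
  move=> r0 r1; have := kP r r0 r1 (conjc k).
  have -> : complex.Re (conjc k * k) = normc k ^+ 2.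
    by case: (k) => a b /=; rewrite sqr_sqrtr ?addr_ge0 ?sqr_ge0//; ring.
  have -> : normc (conjc k) = normc k by case: (k) => a b /=; rewrite sqrrN.
  by rewrite ler_pdivlMr// expr2 mulrAC ger_pMl// mulrC.
apply/ler_addgt0Pr => e e0.
have e1 : 0 < 1 + e by rewrite addr_gt0.
have := kr (1 + e)^-1; rewrite invr_gt0 e1 invf_lt1// ltrDl e0 => /(_ isT isT).
by rewrite ler_pdivrMl// mulr1.
Qed.

Lemma schwarz0 h : holomorphic_on (unit_disc R) h ->
  (forall z, unit_disc R z -> normc (h z) <= 1) -> h 0 = 0 -> normc ('d h 0 1) <= 1.
Proof.
move=> dh hD h0; apply: normc_le1 => r r0 r1; apply: Re_derivative_le => // z zr.
have zD : unit_disc R z.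
  by rewrite /unit_disc /= -[1]/(real_complex R 1) normc_lt (le_lt_trans zr).
by split; [exact: dh|exact: hD].
Qed.

Lemma schwarz_le1 h : holomorphic_on (unit_disc R) h ->
  (forall z, unit_disc R z -> unit_disc R (h z)) -> normc ('d h 0 1) <= 1.
Proof.
move=> dh hD.
have disc0 : unit_disc R 0 by rewrite /unit_disc /= normr0 ltr01.
have discN z : unit_disc R z -> unit_disc R (- z) by rewrite /unit_disc /= normrN.
(* The odd part of [h] vanishes at 0 and has the same derivative there. *)
pose g : cplx R -> cplx R := 2^-1 *: (h - (h \o -%R)).
have dhN z : unit_disc R z -> differentiable (h \o -%R) z.
  by move=> zD; apply: differentiable_comp; [exact: differentiableN|exact/dh/discN].
have dg z : unit_disc R z -> differentiable g z.
  by move=> zD; apply/differentiableZ/differentiableB; [exact: dh|exact: dhN].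
set k := 'd h 0 1.
have gk : 'd g 0 1 = k.
  have dh0 := dh 0 disc0; have dhN0 := dhN 0 disc0.
  have hNk : 'd (h \o -%R) 0 1 = - k.
    exact: diff_compN.
  apply: (etrans (congr1 (fun f => f 1) (diffZ 2^-1 (differentiableB dh0 dhN0)))).
  transitivity (2^-1 * ('d (h - (h \o -%R)) 0 1)); first by [].
  have -> : 'd (h - (h \o -%R)) 0 1 = k - (- k).
    by apply: (etrans (congr1 (fun f => f 1) (diffB dh0 dhN0))); rewrite -hNk.
  by field.
have gE z : g z = 2^-1 * (h z - h (- z)) by [].
have gD z : unit_disc R z -> normc (g z) <= 1.
  move=> zD; rewrite gE; apply: normc_half_sub.
    by move/ltW: (hD z zD); rewrite -[1]/(real_complex R 1) normc_le.
  by move/ltW: (hD _ (discN z zD)); rewrite -[1]/(real_complex R 1) normc_le.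
have g0 : g 0 = 0 by rewrite gE oppr0 subrr mulr0.
by have := schwarz0 dg gD g0; rewrite gk.
Qed.
End Schwarz.

(** * The Kobayashi and Caratheodory metrics of the ball and of the polydisc *)

Section Moebius.
Context {C : numClosedFieldType}.
Implicit Types a t : C.

(** For [a] in the disc, the disc automorphism taking 0 to [a], with inverse [moebius (- a)]. *)
Definition moebius a t : C := (a + t) * (1 + a^* * t)^-1.

Lemma moebius_denom a t : `|a| < 1 -> `|t| < 1 -> 1 + a^* * t != 0.
Proof.
move=> a1 t1; apply/eqP => /(congr1 (fun x => `|x - 1|)).
rewrite addrAC subrr add0r sub0r normrN normrM norm_conjC normr1 => E.
have : `|a| * `|t| < 1 by rewrite mulr_ilt1.
by rewrite E ltxx.
Qed.

Lemma moebius_lt1 a t : `|a| < 1 -> `|t| < 1 -> `|moebius a t| < 1.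
Proof.
move=> a1 t1; have d0 := moebius_denom a1 t1.
rewrite normrM normfV ltr_pdivrMr ?normr_gt0// mul1r.
rewrite -(@ltr_pXn2r _ 2)// ?nnegrE// !normCK !rmorphD !rmorphM /= rmorph1 conjCK -subr_gt0.
(* Squared moduli of denominator and numerator differ by a product of two positive factors. *)
rewrite (_ : _ - _ = (1 - a * a^*) * (1 - t * t^*)); last by ring.
by rewrite -!normCK mulr_gt0// subr_gt0 expr_lt1.
Qed.

Lemma moebius0 a : moebius a 0 = a.
Proof. by rewrite /moebius addr0 mulr0 addr0 invr1 mulr1. Qed.

Lemma is_derive_moebius a b t : 1 + a^* * (b * t) != 0 ->
  is_derive t (1 : C) (fun t => moebius a (b * t))
    ((1 - a * a^*) * b / (1 + a^* * (b * t)) ^+ 2).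
Proof.
move=> d0.
have db : is_derive t (1 : C) (fun t => b * t) b.
  by have := is_deriveZ b (is_derive_id t (1 : C)); rewrite [_ *: _]mulr1.
have dn : is_derive t (1 : C) (fun t => a + b * t) b.
  have := is_deriveD (is_derive_cst a t (1 : C)) db.
  by rewrite add0r.
have dd : is_derive t (1 : C) (fun t => 1 + a^* * (b * t)) (a^* * b).
  have := is_deriveD (is_derive_cst (1 : C) t (1 : C)) (is_deriveZ a^* db).
  by rewrite add0r.
have dv : is_derive t (1 : C) (fun t => (1 + a^* * (b * t))^-1)
    (- (a^* * b) / (1 + a^* * (b * t)) ^+ 2).
  apply: DeriveDef; first exact: derivableV.
  rewrite deriveV//.
  by case: dd => _ ->; rewrite /GRing.scale /= mulNr mulrC mulNr.
apply: (is_derive_eq (is_deriveM dn dv)).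
by rewrite /GRing.scale /=; field.
Qed.

Lemma diff_moebius_opp a : `|a| < 1 ->
  is_diff a (moebius (- a)) (fun h => h / (1 - a * a^*)).
Proof.
move=> a1; have d0 : 1 + (- a)^* * (1 * a) != 0.
  by rewrite mul1r; apply: moebius_denom; rewrite ?normrN.
have := is_derive_moebius d0.
rewrite (_ : (fun t => moebius (- a) (1 * t)) = moebius (- a)); last first.
  by apply/funext => t; rewrite mul1r.
move=> [dm dE]; split; first exact/derivable1_diffP.
rewrite deriv1E// derive1E dE; apply/funext => h; rewrite /GRing.scale /=.
move: d0; rewrite rmorphN/= !mul1r mulNr [_^* * _]mulrC => d0.
by field.
Qed.

End Moebius.

(** * Comparison of the two metrics and their explicit bounds *)

Section Metrics.
Context {R : realType} {n : nat}.
Notation C := (cplx R).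
Implicit Types (D : set 'rV[C]_n) (z xi : 'rV[C]_n).

(** For competitors [phi] and [f], the composite [f \o phi] maps the disc to itself with derivative
    [al] times ['d f z xi], so the Schwarz estimate applies. *)
Lemma caratheodory_le_kobayashi D z xi : D z ->
  (caratheodory D z xi <= kobayashi D z xi)%E.
Proof.
move=> Dz; apply: le_ereal_inf_tmp => _ [al al0 [->] [phi [dphi phiD phi0 phi1]]].
apply: ge_ereal_sup => _ [f [df fD ->]]; rewrite lee_fin.
have disc0 : unit_disc R 0 by rewrite /unit_disc /= normr0 ltr01.
have h1 : normc ('d (f \o phi) 0 1) <= 1.
  apply: schwarz_le1 => t tD /=; last exact/fD/phiD.
  by apply: differentiable_comp; [exact: dphi|exact/df/phiD].
have hE : 'd (f \o phi) 0 1 = (real_complex R al : C) * 'd f z xi.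
  have dphi0 := dphi 0 disc0; have dfz := df _ (phiD 0 disc0).
  apply: (etrans (congr1 (fun g => g 1) (diff_comp dphi0 dfz))).
  rewrite /= -derive1E'// phi1 phi0.
  exact: linearZ.
move: h1; rewrite hE ComplexField.Normc.normcM.
have -> : normc (real_complex R al) = al by rewrite /= expr0n/= addr0 sqrtr_sqr gtr0_norm.
by rewrite -ler_pdivlMl// mulr1.
Qed.

Lemma rV_sum_delta (T : Type) (f : T -> 'rV[C]_n) :
  f = fun t => (\sum_(i < n) (fun t => f t 0 i *: delta_mx 0 i)) t.
Proof. by apply/funext => t; rewrite fct_sumE; exact: row_sum_delta. Qed.

Lemma differentiable_rV (V : normedModType C) (f : V -> 'rV[C]_n) t :
  (forall i, differentiable (fun t => f t 0 i) t) -> differentiable f t.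
Proof.
move=> df; rewrite (rV_sum_delta f).
by apply: differentiable_sum => i; exact: differentiableZl.
Qed.

(** The pairing has no conjugation, which makes it complex linear and hence holomorphic in [w]. *)
Definition linear_form (c : 'rV[C]_n) (w : 'rV[C]_n) : C := \sum_(i < n) c 0 i * w 0 i.

Lemma linear_form_linear c : linear (linear_form c).
Proof.
move=> k u v; rewrite /linear_form scaler_sumr -big_split /=; apply: eq_bigr => i _.
by rewrite !mxE mulrDr mulrCA.
Qed.

HB.instance Definition _ c :=
  GRing.isLinear.Build C 'rV[C]_n C *%R (linear_form c) (linear_form_linear c).

Lemma linear_form_continuous c : continuous (linear_form c).
Proof.
have E : linear_form c = \sum_(i < n) (fun w : 'rV[C]_n => c 0 i *: (w 0 i : C)).
  by apply/funext => w; rewrite fct_sumE.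
move=> w; suff : differentiable (linear_form c) w by exact: differentiable_continuous.
rewrite E; apply: differentiable_sum => i.
exact/differentiableZ/differentiable_coord.
Qed.

Lemma is_diff_linear_form c w : is_diff w (linear_form c) (linear_form c).
Proof.
split; first by apply: linear_differentiable; exact: linear_form_continuous.
by rewrite diff_lin //; exact: linear_form_continuous.
Qed.

Lemma is_diff_coord i (w : 'rV[C]_n) :
  is_diff w (fun w => w 0 i) (fun w => w 0 i).
Proof.
suff -> : (fun w : 'rV[C]_n => w 0 i) = linear_form (delta_mx 0 i).
  exact: is_diff_linear_form.
apply/funext => v; rewrite /linear_form (bigD1 i)//= mxE !eqxx mul1r big1 ?addr0//.
by move=> j ji; rewrite mxE eqxx (negbTE ji) mul0r.
Qed.

Lemma derive1_rV (f : C -> 'rV[C]_n) (d : 'rV[C]_n) (t : C) :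
  (forall i, is_derive t (1 : C) (fun t => f t 0 i) (d 0 i)) -> derive1 f t = d.
Proof.
move=> df.
have di i : differentiable (fun t => f t 0 i) t by apply/derivable1_diffP; case: (df i).
have dft : differentiable f t by exact: differentiable_rV.
rewrite derive1E'//; apply/rowP => i.
have [_ <-] := df i.
rewrite deriveE//.
have dc := is_diff_coord i (f t).
have [_ E] := is_diff_comp (differentiableP dft) dc.
by apply: esym; exact: (congr1 (fun g => g 1) E).
Qed.

Definition sqnorm (z : 'rV[C]_n) : R := \sum_(i < n) normc (z 0 i) ^+ 2.

Lemma sqnorm_ge0 z : 0 <= sqnorm z.
Proof. by apply: sumr_ge0 => i _; exact: sqr_ge0. Qed.

Lemma unit_ballE z : unit_ball R n z = (sqnorm z < 1) :> Prop.
Proof.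
rewrite /unit_ball /= (eq_bigr (fun i => real_complex R (normc (z 0 i) ^+ 2))); last first.
  by move=> i _; rewrite rmorphXn.
by rewrite -rmorph_sum -[1]/(real_complex R 1) ltcR.
Qed.

Lemma unit_discE (t : C) : unit_disc R t = (normc t < 1) :> Prop.
Proof. by rewrite /unit_disc /= -[1]/(real_complex R 1) normc_lt. Qed.

Lemma normc_real (r : R) : normc (real_complex R r) = `|r|.
Proof. by rewrite /= expr0n /= addr0 sqrtr_sqr. Qed.

Lemma sqnormZ (t : C) z : sqnorm (t *: z) = normc t ^+ 2 * sqnorm z.
Proof.
rewrite /sqnorm mulr_sumr; apply: eq_bigr => i _.
by rewrite mxE ComplexField.Normc.normcM exprMn.
Qed.

(** Termwise, the modulus of a product is at most half the sum of the squared moduli. *)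
Lemma normc_linear_form_lt c w : sqnorm c <= 1 -> sqnorm w < 1 ->
  normc (linear_form c w) < 1.
Proof.
move=> c1 w1.
have : normc (linear_form c w) <= \sum_(i < n) (normc (c 0 i) ^+ 2 + normc (w 0 i) ^+ 2) / 2.
  rewrite -normc_le rmorph_sum /= (le_trans (ler_norm_sum _ _ _))//.
  apply: ler_sum => i _; rewrite normc_le ComplexField.Normc.normcM.
  by have := sqr_ge0 (normc (c 0 i) - normc (w 0 i)); rewrite sqrrB; lra.
rewrite -mulr_suml big_split /= -!/(sqnorm _) => /le_lt_trans; apply; lra.
Qed.

Lemma caratheodory_ball_ge xi :
  ((Num.sqrt (sqnorm xi))%:E <= caratheodory (unit_ball R n) 0 xi)%E.
Proof.
set N := Num.sqrt _.
have N2 : N * N = sqnorm xi by rewrite -expr2 sqr_sqrtr ?sqnorm_ge0.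
(* The norming functional of [xi], with value [N] at [xi]. For [xi = 0], the default [0^-1 = 0]
   gives the zero form, which still works. *)
pose c : 'rV[C]_n := real_complex R N^-1 *: \row_i conjc (xi 0 i).
have c1 : sqnorm c <= 1.
  rewrite sqnormZ normc_real real_normK ?num_real//.
  rewrite (_ : sqnorm (\row__ _) = sqnorm xi); last first.
    apply: eq_bigr => i _; rewrite mxE; congr (_ ^+ 2).
    by case: (xi 0 i) => x y /=; rewrite sqrrN.
  rewrite -N2 expr2 mulrACA; have [->|N0] := eqVneq N 0; first by rewrite mulr0 mul0r ler01.
  by rewrite mulVf ?mul1r.
apply: le_ereal_sup_tmp; exists N%:E => //; exists (linear_form c); split.
- by move=> w _; case: (is_diff_linear_form c w).
- by move=> w; rewrite unit_ballE unit_discE; exact: normc_linear_form_lt.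
- congr EFin; have [_ E] := is_diff_linear_form c 0; rewrite (congr1 (fun f => f xi) E).
  have -> : linear_form c xi = real_complex R (N^-1 * sqnorm xi).
    rewrite /linear_form rmorphM /= /sqnorm rmorph_sum mulr_sumr; apply: eq_bigr => i _.
    rewrite !mxE -mulrA; congr (_ * _); rewrite rmorphXn /= -normC_normc.
    by rewrite [_ ^+ 2]sqr_normc mulrC.
  rewrite normc_real -N2 mulrA ger0_norm; last first.
    by rewrite mulr_ge0 ?sqrtr_ge0// mulr_ge0 ?invr_ge0 ?sqrtr_ge0.
  by have [->|N0] := eqVneq N 0; [rewrite mulr0|rewrite mulVf ?mul1r].
Qed.

(** The linear disc [t *: (xi / N)] is a competitor; a free bound [N > 0] also admits [xi = 0]. *)
Lemma kobayashi_ball_le xi (N : R) : 0 < N -> sqnorm xi <= N ^+ 2 ->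
  (kobayashi (unit_ball R n) 0 xi <= N%:E)%E.
Proof.
move=> N0 xiN.
pose v : 'rV[C]_n := real_complex R N^-1 *: xi.
have v1 : sqnorm v <= 1.
  rewrite sqnormZ normc_real real_normK ?num_real// exprVn.
  by rewrite ler_pdivrMl ?exprn_gt0// mulr1.
apply: ge_ereal_inf; exists N%:E => //; exists N^-1; first by rewrite invr_gt0.
split; first by rewrite invrK.
exists (fun t => t *: v); split.
- by move=> t _; case: (is_diff_scalel t v).
- move=> t; rewrite unit_discE unit_ballE sqnormZ => t1.
  rewrite (le_lt_trans (ler_piMr (sqr_ge0 _) v1))//.
  by rewrite expr_lt1// normc_ge0.
- by rewrite scale0r.
- have [d E] := is_diff_scalel (0 : C) v; rewrite derive1E'// (congr1 (fun f => f 1) E).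
  by rewrite /= scale1r.
Qed.

(* The image of [b] under the differential at 0 of the automorphism of the
   polydisc that maps 0 to [a]. *)
Definition polydisc_vector (a : 'rV[C]_n) (b : 'I_n -> C) : 'rV[C]_n :=
  \row_i ((1 - a 0 i * (a 0 i)^*%R) * b i).

(** The competitor is the disc with coordinates [moebius (a 0 i) (b i * t)], taken with
    [alpha = 1]. *)
Lemma kobayashi_polydisc_le a b : unit_polydisc R n a -> (forall i, `|b i| <= 1) ->
  (kobayashi (unit_polydisc R n) a (polydisc_vector a b) <= 1%:E)%E.
Proof.
move=> aD b1.
have bt i t : unit_disc R t -> `|b i * t| < 1.
  by move=> tD; rewrite normrM; apply: le_lt_trans tD; rewrite ler_piMl.
apply: ge_ereal_inf; exists 1%:E => //; exists 1 => //; split; first by rewrite invr1.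
exists (fun t => \row_i moebius (a 0 i) (b i * t)); split.
- move=> t tD; apply: differentiable_rV => i; apply/derivable1_diffP.
  under eq_fun do rewrite mxE.
  have dn := moebius_denom (aD i) (bt i t tD).
  by case: (is_derive_moebius dn).
- by move=> t tD i; rewrite mxE; apply: moebius_lt1; [exact: aD|exact: bt].
- by apply/rowP => i; rewrite mxE mulr0 moebius0.
- rewrite scale1r; apply: derive1_rV => i; under eq_fun do rewrite mxE.
  have dn : 1 + (a 0 i)^*%R * (b i * 0) != 0 by rewrite !mulr0 addr0 oner_eq0.
  apply: (is_derive_eq (is_derive_moebius dn)).
  by rewrite !mulr0 addr0 expr1n divr1 mxE.
Qed.

(** The [i]-th coordinate followed by the Moebius map taking [a 0 i] to 0 has a differential sending
    this vector to [b i]. *)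
Lemma caratheodory_polydisc_ge a b i : unit_polydisc R n a -> normc (b i) = 1 ->
  (1%:E <= caratheodory (unit_polydisc R n) a (polydisc_vector a b))%E.
Proof.
move=> aD b1; have d0 : 1 - a 0 i * (a 0 i)^*%R != 0.
  by rewrite -normCK subr_eq0 eq_sym lt_eqF// expr_lt1//; exact: aD.
apply: le_ereal_sup_tmp; exists 1%:E => //.
exists (fun w => moebius (- a 0 i) (w 0 i)); split.
- move=> w wD; apply: (@differentiable_comp _ _ _ _ (fun w : 'rV[C]_n => w 0 i) (moebius (- a 0 i))).
    exact: differentiable_coord.
  apply/derivable1_diffP.
  have dn : 1 + (- a 0 i)^*%R * (1 * w 0 i) != 0.
    by rewrite mul1r; apply: moebius_denom; rewrite ?normrN; [exact: aD|exact: wD].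
  have [+ _] := is_derive_moebius dn.
  by under eq_fun do rewrite mul1r.
- by move=> w wD; apply: moebius_lt1; rewrite ?normrN; [exact: aD|exact: wD].
- congr EFin; rewrite -b1; congr normc.
  have [_ E] := is_diff_comp (is_diff_coord i a) (diff_moebius_opp (aD i)).
  rewrite (congr1 (fun f => f (polydisc_vector a b)) E) /= mxE.
  by field.
Qed.

End Metrics.

(** * Nonexistence of isometries *)

Section Nonexistence.
Context {R : realType} {n : nat}.
Notation C := (cplx R).
Implicit Types (v w : 'rV[R]_(n + n)) (z xi eta : 'rV[C]_n).

Lemma to_cplxD v w : to_cplx (v + w) = to_cplx v + to_cplx w.
Proof. by apply/rowP => i; rewrite !mxE. Qed.

Lemma to_cplxB v w : to_cplx (v - w) = to_cplx v - to_cplx w.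
Proof. by apply/rowP => i; rewrite !mxE. Qed.

Lemma of_cplx0 : of_cplx (0 : 'rV[C]_n) = 0.
Proof.
rewrite /of_cplx -[RHS]row_mx0; congr row_mx; apply/rowP => i; by rewrite !mxE.
Qed.

Lemma to_cplxZ (t : R) v : to_cplx (t *: v) = real_complex R t *: to_cplx v.
Proof.
apply/rowP => i; rewrite !mxE /real_complex_def; apply/eqP.
by rewrite eq_complex /= !mul0r subr0 addr0 !eqxx.
Qed.

Lemma sqnorm_eq0 z : sqnorm z = 0 -> z = 0.
Proof.
move=> z0; apply/rowP => i; rewrite mxE; apply: ComplexField.Normc.eq0_normc.
have /psumr_eq0P := z0 => /(_ (fun _ _ => sqr_ge0 _))/(_ i isT)/eqP.
by rewrite sqrf_eq0 => /eqP.
Qed.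

Lemma sqnorm_parallelogram xi eta :
  sqnorm (xi + eta) + sqnorm (xi - eta) = 2 * (sqnorm xi + sqnorm eta).
Proof.
rewrite /sqnorm -!big_split mulr_sumr; apply: eq_bigr => i _; rewrite !mxE /=.
case: (xi 0 i) => a b; case: (eta 0 i) => c d /=.
by rewrite !sqr_sqrtr ?addr_ge0 ?sqr_ge0//; ring.
Qed.

Lemma inj_linear_surj (m : nat) (l : {linear 'rV[R]_m -> 'rV[R]_m}) :
  (forall u : 'rV[R]_m, l u = 0 -> u = 0) -> forall y, exists u, l u = y.
Proof.
move=> li y; have Au : lin1_mx l \in unitmx.
  rewrite -row_free_unit; apply: inj_row_free => u; rewrite mul_rV_lin1; exact: li.
by exists (y *m invmx (lin1_mx l)); rewrite -mul_rV_lin1 mulmxKV.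
Qed.

(** This common property lets one argument treat both metrics. *)
Definition between_metrics (F : set 'rV[C]_n -> 'rV[C]_n -> 'rV[C]_n -> \bar R) :=
  forall D z xi, D z ->
    (caratheodory D z xi <= F D z xi)%E /\ (F D z xi <= kobayashi D z xi)%E.

(** Let [v] and [w] be the preimages of the vectors given by two distinct coordinate directions.
    Then [v] and [w] have squared norm at least 1 and [v + w], [v - w] at most 1, so the
    parallelogram law would give [4 <= 2]. *)
Lemma no_linear_isometry F (a : 'rV[C]_n) (l : {linear 'rV[R]_(n + n) -> 'rV[R]_(n + n)}) :
  (1 < n)%N -> between_metrics F -> unit_polydisc R n a ->
  ~ (forall v, F (unit_polydisc R n) a (to_cplx (l v)) = F (unit_ball R n) 0 (to_cplx v)).
Proof.
move=> n1 FCK aP lF.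
have B0 : unit_ball R n 0.
  rewrite unit_ballE /sqnorm big1 ?ltr01// => i _.
  by rewrite mxE ComplexField.Normc.normc0 expr0n.
have le1 v b : to_cplx (l v) = polydisc_vector a b -> (forall i, `|b i| <= 1) ->
    sqnorm (to_cplx v) <= 1.
  move=> lvb b1.
  have : ((Num.sqrt (sqnorm (to_cplx v)))%:E <= 1%:E)%E.
    apply: (le_trans (caratheodory_ball_ge _)); apply: (le_trans (FCK _ _ _ B0).1).
    rewrite -lF lvb; apply: (le_trans (FCK _ _ _ aP).2).
    exact: kobayashi_polydisc_le.
  by rewrite lee_fin => N1; rewrite -ler_sqrt ?ler01// sqrtr1.
have ge1 v b i : to_cplx (l v) = polydisc_vector a b -> normc (b i) = 1 ->
    1 <= sqnorm (to_cplx v).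
  move=> lvb b1; rewrite leNgt; apply/negP => v1.
  have s0 := sqnorm_ge0 (to_cplx v).
  set s := sqnorm _ in v1 s0.
  (* The midpoint of [s] and 1 is below 1 and stays positive when [s = 0], as [kobayashi_ball_le]
     requires. *)
  have t0 : 0 < (s + 1) / 2 by rewrite divr_gt0// ltr_wpDl.
  have : (1%:E <= (Num.sqrt ((s + 1) / 2))%:E)%E.
    apply: (le_trans (caratheodory_polydisc_ge aP b1)); rewrite -lvb.
    apply: (le_trans (FCK _ _ _ aP).1); rewrite lF.
    apply: (le_trans (FCK _ _ _ B0).2).
    apply: kobayashi_ball_le; first by rewrite sqrtr_gt0.
    rewrite sqr_sqrtr; last exact/ltW.
    by rewrite -/s ler_pdivlMr// mulr_natr mulr2n lerD// ltW.
  rewrite lee_fin -{1}[1](sqrtr1 R) ler_sqrt ?(ltW t0)// ler_pdivlMr// mul1r; lra.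
(* [l] kills every multiple of [v], so all of these have norm at most 1. *)
have linj v : l v = 0 -> v = 0.
  move=> lv0; rewrite -(to_cplxK v).
  suff -> : to_cplx v = 0 by exact: of_cplx0.
  apply: sqnorm_eq0; apply/eqP; rewrite eq_le sqnorm_ge0 andbT leNgt; apply/negP => s0.
  (* This multiple has squared norm 4, which exceeds the bound 1. *)
  have := le1 ((2 / Num.sqrt (sqnorm (to_cplx v))) *: v) (fun=> 0).
  rewrite linearZ /= lv0 scaler0 to_cplxZ sqnormZ normc_real real_normK ?num_real//.
  rewrite exprMn exprVn sqr_sqrtr ?sqnorm_ge0// mulfVK ?gt_eqF//.
  have E0 : to_cplx 0 = polydisc_vector a (fun=> 0) by apply/rowP => i; rewrite !mxE mulr0.
  move=> /(_ E0) h; have : (2 ^+ 2 : R) <= 1 by apply: h => _; rewrite normr0 ler01.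
  by clear -R; lra.
have lsurj := inj_linear_surj linj.
pose i0 := Ordinal (ltnW n1); pose i1 := Ordinal n1.
pose b0 (i : 'I_n) : C := (i == i0)%:R; pose b1 (i : 'I_n) : C := (i == i1)%:R.
have i01 : i0 != i1 by [].
have [v vE] := lsurj (of_cplx (polydisc_vector a b0)).
have [w wE] := lsurj (of_cplx (polydisc_vector a b1)).
have vb : to_cplx (l v) = polydisc_vector a b0 by rewrite vE of_cplxK.
have wb : to_cplx (l w) = polydisc_vector a b1 by rewrite wE of_cplxK.
have v1 : 1 <= sqnorm (to_cplx v).
  by apply: (ge1 _ _ i0 vb); rewrite /b0 eqxx ComplexField.Normc.normc1.
have w1 : 1 <= sqnorm (to_cplx w).
  by apply: (ge1 _ _ i1 wb); rewrite /b1 eqxx ComplexField.Normc.normc1.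
(* As [i0] and [i1] differ, the entries of [b0 + b1] and [b0 - b1] are 0, 1 or -1, so [le1] applies
   to both. *)
have vw1 : sqnorm (to_cplx v + to_cplx w) <= 1.
  rewrite -to_cplxD; apply: (@le1 _ (fun i => b0 i + b1 i)).
    rewrite linearD to_cplxD vb wb; apply/rowP => i; rewrite !mxE; ring.
  move=> i; rewrite /b0 /b1; have [->|_] := eqVneq i i0.
    by rewrite (negbTE i01) addr0 normr1.
  by case: (_ == _); rewrite add0r ?normr1 ?normr0 ?ler01.
have vw2 : sqnorm (to_cplx v - to_cplx w) <= 1.
  rewrite -to_cplxB; apply: (@le1 _ (fun i => b0 i - b1 i)).
    rewrite linearB to_cplxB vb wb; apply/rowP => i; rewrite !mxE; ring.
  move=> i; rewrite /b0 /b1; have [->|_] := eqVneq i i0.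
    by rewrite (negbTE i01) subr0 normr1.
  by case: (_ == _); rewrite add0r normrN ?normr1 ?normr0 ?ler01.
have := sqnorm_parallelogram (to_cplx v) (to_cplx w); lra.
Qed.

(** The isometry condition at the centre makes the real differential there a linear map of the kind
    just excluded, with [a = f 0]. *)
Lemma no_isometry F (f : 'rV[C]_n -> 'rV[C]_n) : (1 < n)%N ->
  between_metrics F -> C1_diffeomorphism (unit_ball R n) (unit_polydisc R n) f ->
  ~ (forall z, unit_ball R n z -> forall xi,
      F (unit_polydisc R n) (f z) (real_diff f z xi) = F (unit_ball R n) z xi).
Proof.
move=> n1 FCK [g [fD _ _ _]] fF.
have B0 : unit_ball R n 0.
  rewrite unit_ballE /sqnorm big1 ?ltr01// => i _.
  by rewrite mxE ComplexField.Normc.normc0 expr0n.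
apply: (no_linear_isometry (l := 'd (realify f) (of_cplx 0)) n1 FCK (fD 0 B0).1) => v.
by rewrite -(fF 0 B0 (to_cplx v)) /real_diff to_cplxK.
Qed.

End Nonexistence.

Theorem theorem1p1 (R : realType) (n : nat) (hn : (1 < n)%N) :
  ~ (exists f : 'rV[cplx R]_n -> 'rV[cplx R]_n,
       C1_kobayashi_isometry (unit_ball R n) (unit_polydisc R n) f) /\
  ~ (exists f : 'rV[cplx R]_n -> 'rV[cplx R]_n,
       C1_caratheodory_isometry (unit_ball R n) (unit_polydisc R n) f).
Proof.
split=> -[f [fdiff fiso]].
- apply: (no_isometry hn _ fdiff fiso) => D z xi Dz; split => //.
  exact: caratheodory_le_kobayashi.
- apply: (no_isometry hn _ fdiff fiso) => D z xi Dz; split => //.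
  exact: caratheodory_le_kobayashi.
Qed.
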